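(* Let $\{X_n\}_{n\in\mathbb{Z}}$ be compact metric spaces, $\{T_n\colon X_n\to X_{n+1}\}_{n\in\mathbb{Z}}$ continuous maps, and $\{\varphi_n\colon X_n\to\mathbb{R}\}_{n\in\mathbb{Z}}$ continuous potentials, and let $L_n\colon C(X_n)\to C(X_{n+1})$ be the operators $(L_nf)(x)=\sum_{y\in T_n^{-1}(x)}e^{\varphi_n(y)}f(y)$. Suppose that $\lambda_n\in(0,\infty)$, $m_n\in M(X_n)$, and $h_n\in C_n^+$ are such that $$L_nh_n=\lambda_nh_{n+1},\qquad L_n^*m_{n+1}=\lambda_nm_n,\qquad \langle h_n,m_n\rangle=1\qquad\text{for every }n\in\mathbb{Z}.$$ Then the measures $\mu_n\in M(X_n)$ defined by $\mu_n(E)=\int_Eh_n\,dm_n$ satisfy $(T_n)_*\mu_n=\mu_{n+1}$ for all $n\in\mathbb{Z}$. If in addition $h_n>0$ for all $n$, then considering the normalized potential $$\widetilde\varphi_n:=\varphi_n+\log h_n-\log h_{n+1}\circ T_n-\log\lambda_n$$ and writing $(\widetilde L_nf)(x)=\sum_{y\in T_n^{-1}(x)}e^{\widetilde\varphi_n(y)}f(y)$ for the associated operator and $\widetilde{\mathbf{L}}_n^k=\widetilde L_{n+k-1}\circ\cdots\circ\widetilde L_n$, we have $$\widetilde{\mathbf{L}}_n^kf=\frac{\mathbf{L}_n^k(h_nf)}{\boldsymbol{\lambda}_n^k\,h_{n+k}}\qquad\text{for every } n\in\mathbb{Z},\ k\in\mathbb{N},\ f\in C(X_n),$$ and $$\widetilde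 L_n\mathbf{1}=\mathbf{1}\quad\text{and}\quad \widetilde L_n^*\mu_{n+1}=\mu_n\quad\text{for every }n\in\mathbb{Z}.$$
   Context: It is part of the setting that the formula for $L_n$ defines an operator $C(X_n)\to C(X_{n+1})$ (in particular each fibre $T_n^{-1}(x)$ is finite). $C_n^+=\{f\in C(X_n):f\ge0,\ f\not\equiv0\}$. $M(X_n)$ is the set of positive finite Borel measures on $X_n$; $\langle f,m\rangle=\int f\,dm$. The dual operator $L_n^*\colon M(X_{n+1})\to M(X_n)$ is defined by $\langle f,L_n^*m\rangle=\langle L_nf,m\rangle$ for all $f\in C(X_n)$, and $\widetilde L_n^*$ is defined likewise from $\widetilde L_n$. $\mathbf{L}_n^k=L_{n+k-1}\circ\cdots\circ L_n$, $\boldsymbol{\lambda}_n^k=\prod_{j=0}^{k-1}\lambda_{n+j}$, and $\mathbf{1}$ is the constant function $1$. $(T_n)_*\mu_n$ is the pushforward measure. *)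

(* Defs.v *)
From HB Require Import structures.
From mathcomp Require Import all_boot all_order all_algebra.
From mathcomp Require Import all_classical all_reals all_analysis.
From mathcomp Require Import measurable_realfun.

Set Implicit Arguments.
Unset Strict Implicit.
Unset Printing Implicit Defensive.
Import Order.TTheory GRing.Theory Num.Theory.
Import numFieldNormedType.Exports.
Local Open Scope classical_set_scope.
Local Open Scope ring_scope.

HB.mixin Record isCompactSpace T & Topological T := {
  compactT : compact [set: T]
}.

(* The base point carries no information beyond nonemptiness; measurableType
   requires it. *)
#[short(type="compactMetricType")]
HB.structure Definition CompactMetric (R : numDomainType) :=
  {T of Pointed T & Metric R T & isCompactSpace T}.

Section Spaces.
Context {R : realType}.

Definition borel (X : compactMetricType R) := g_sigma_algebraType (@open X).

Definition borel_measure (X : compactMetricType R) :=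
  {finite_measure set (borel X) -> \bar R}.

Record Cplus (X : compactMetricType R) := {
  Cplus_fun :> X -> R ;
  Cplus_continuous : continuous Cplus_fun ;
  Cplus_ge0 : forall x, 0 <= Cplus_fun x ;
  Cplus_neq0 : exists x, Cplus_fun x != 0
}.

Definition pairing (X : compactMetricType R) (f : X -> R)
    (m : borel_measure X) : \bar R :=
  (\int[m]_x (f x)%:E)%E.

Lemma continuous_borel_measurable (X : compactMetricType R) (f : X -> R) :
  continuous f -> measurable_fun [set: borel X] (f : borel X -> R).
Proof.
move=> /continuousP cf; apply: (measurability _ (RGenOpens.measurableE R)).
move=> _ [_ [a [b ->]] <-]; rewrite setTI.
by apply: sub_sigma_algebra; apply: cf; exact: interval_open.
Qed.

Definition density (X : compactMetricType R) (m : borel_measure X)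
    (h : Cplus X) : set (borel X) -> \bar R :=
  fun E => (\int[m]_(x in E) (h x)%:E)%E.

Section density_measure.
Context {X : compactMetricType R} (m : borel_measure X) (h : Cplus X).
Local Open Scope ereal_scope.

Let mh : measurable_fun [set: borel X] (fun x : borel X => (h x)%:E).
Proof.
apply/measurable_EFinP.
exact: (continuous_borel_measurable (@Cplus_continuous _ h)).
Qed.

Let density0 : density m h set0 = 0.
Proof. exact: integral_set0. Qed.

Let density_ge0 E : 0 <= density m h E.
Proof. by apply: integral_ge0 => x _; rewrite lee_fin Cplus_ge0. Qed.

Let density_sigma_additive : semi_sigma_additive (density m h).
Proof.
move=> F mF tF mUF; rewrite /density; apply: cvg_toP.
  apply: ereal_nondecreasing_is_cvgn => i j ij.
  apply: lee_sum_nneg_natr => // k _ _; exact: density_ge0.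
rewrite ge0_integral_bigcup//=.
- exact: measurable_funTS.
- by move=> x _; rewrite lee_fin Cplus_ge0.
Qed.

HB.instance Definition _ := isMeasure.Build _ _ _ (density m h)
  density0 density_ge0 density_sigma_additive.

Let density_fin : fin_num_fun (density m h).
Proof.
move=> E mE; rewrite ge0_fin_numE ?density_ge0//.
have [c _ hc] : exists2 c, c \in [set: X] & forall t, t \in [set: X] -> (h t <= h c)%R.
  apply: compact_EVT_max; [by exists point|exact: compactT|].
  exact/continuous_subspaceT/Cplus_continuous.
apply: (@le_lt_trans _ _ (\int[m]_(x in E) (h c)%:E)).
  apply: ge0_le_integral => //.
  - by move=> x _; rewrite lee_fin Cplus_ge0.
  - exact: measurable_funTS.
  - by move=> x _; rewrite lee_fin hc// in_setT.
rewrite integral_cst// ltey_eq fin_numM//.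
exact: fin_num_measure.
Qed.

HB.instance Definition _ := @Measure_isFinite.Build _ _ _ (density m h)
  density_fin.

End density_measure.

(* An operator is given on all real functions; this says that it restricts to
   an operator C(X) -> C(Y). *)
Definition preserves_continuity (X Y : compactMetricType R)
    (A : (X -> R) -> (Y -> R)) : Prop :=
  forall f : X -> R, continuous f -> continuous (A f).

(* [dual_eq A m' m] is A^* m' = m, through the defining property of the dual
   operator A^* : M(Y) -> M(X) of an operator A : C(X) -> C(Y); a finite Borel
   measure is determined by its pairings with C(X). *)
Definition dual_eq (X Y : compactMetricType R) (A : (X -> R) -> (Y -> R))
    (m' : borel_measure Y) (m : borel_measure X) : Prop :=
  forall f : X -> R, continuous f -> pairing f m = pairing (A f) m'.

(* The sum over the fibre is the finitely supported one, so it is meaningful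
   only for finite fibres. *)
Definition transfer (X Y : compactMetricType R) (T : X -> Y) (phi : X -> R)
    (f : X -> R) : Y -> R :=
  fun x => \sum_(y \in T @^-1` [set x]) expR (phi y) * f y.

End Spaces.

(* n + k, computed by iterated successor so that X (index_add n k.+1) is
   convertible to X (index_add n k + 1). *)
Fixpoint index_add (n : int) (k : nat) : int :=
  if k is k'.+1 then index_add n k' + 1 else n.

Lemma index_addE n k : index_add n k = n + k%:Z.
Proof.
by elim: k => [|k IHk] /=; rewrite ?addr0// IHk -addrA -PoszD addn1.
Qed.

Fixpoint iter_op (R : realType) (X : int -> compactMetricType R)
    (L : forall n, (X n -> R) -> (X (n + 1) -> R)) (n : int) (k : nat) :
    (X n -> R) -> (X (index_add n k) -> R) :=
  match k return (X n -> R) -> (X (index_add n k) -> R) with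
  | 0 => id
  | k'.+1 => fun f => L (index_add n k') (@iter_op R X L n k' f)
  end.

Arguments iter_op {R X} L n k f.

Definition normalized_potential (R : realType) (X : int -> compactMetricType R)
    (T : forall n, X n -> X (n + 1)) (phi : forall n, X n -> R)
    (lam : int -> {posnum R}) (h : forall n, Cplus (X n)) (n : int) :
    X n -> R :=
  fun y => phi n y + ln (h n y) - ln (h (n + 1) (T n y)) - ln (lam n)%:num.

Arguments normalized_potential {R X} T phi lam h n.

(* Main.v *)
Require Import Defs.
From HB Require Import structures.
From mathcomp Require Import all_boot all_order all_algebra.
From mathcomp Require Import all_classical all_reals all_analysis.
From mathcomp Require Import measurable_realfun.
From mathcomp Require Import ring.

Set Implicit Arguments.
Unset Strict Implicit.
Unset Printing Implicit Defensive.
Import Order.TTheory GRing.Theory Num.Theory.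
Import numFieldNormedType.Exports.
Local Open Scope classical_set_scope.
Local Open Scope ring_scope.

(** Everything comes from two identities for a transfer operator
[L f (x) = sum over the fibre of exp phi * f]:
- functions of the image pull out: [L ((g o T) * f) = g * L f]
  ([transfer_comp]);
- the normalized operator is a conjugate of [L], that is
  [L' f = L (h * f) / (lam * h')] ([transfer_normalized]), because on the fibre
  of [x] the factor [h' (T y)] is the constant [h' x].

Write [mu = h m] and [mu' = h' m'].  Since [L^* m' = lam m], the integral of
a nonnegative continuous [f] against [mu] is [lam^-1] times the integral of
[L (f * h)] against [m'] ([pairing_density_transfer]).  For [f = g o T] the first identity and
[L h = lam h'] turn this into the integral of [g] against [mu'], so [T_* mu]
and [mu'] integrate nonnegative continuous functions alike, and two finite
Borel measures on a metric space with this property are equal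
([eq_measure_continuous]).  For any [f] the second identity turns it into
the integral of [L' f] against [mu'], which is the duality [L'^* mu' = mu],
since by linearity nonnegative [f] suffice there ([dual_eq_ge0]).  The formula for the
iterates of [L'] telescopes: the factor [h] that [L'] inserts cancels the
denominator left by the preceding step. *)

(** * Integration against a measure with a density *)

Section integral_of_density.
Local Open Scope ereal_scope.
Context d (T : measurableType d) (R : realType).
Variables (mu nu : {measure set T -> \bar R}) (h : T -> R).
Hypotheses (mh : measurable_fun setT h) (h0 : forall x, (0 <= h x)%R).
Hypothesis nuE :
  forall E, measurable E -> nu E = \int[mu]_(x in E) (h x)%:E.

Import HBNNSimple.

(* For a simple function both sides are combinations of the measures of its
   level sets, where the hypothesis on nu applies. *)
Let integral_density_nnsfun (g : {nnsfun T >-> R}) :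
  \int[nu]_x (g x)%:E = \int[mu]_x (g x * h x)%:E.
Proof.
have mhE : measurable_fun setT (EFin \o h) by exact/measurable_EFinP.
have indich r : measurable_fun setT
    (fun x => (r * \1_(g @^-1` [set r]) x)%:E : \bar R).
  by apply/measurable_EFinP; exact: measurable_funM.
under eq_integral do rewrite fimfunE -fsumEFin//.
rewrite ge0_integral_fsum//; last by move=> m y _; exact: nnfun_muleindic_ge0.
under [RHS]eq_integral => x _.
  rewrite EFinM fimfunE -fsumEFin// ge0_mule_fsuml; last first.
    by move=> y; exact: nnfun_muleindic_ge0.
  over.
rewrite ge0_integral_fsum//; last 2 first.
- by move=> y; exact: emeasurable_funM.
- move=> m y _; rewrite mule_ge0 ?lee_fin// -lee_fin EFinM.
  exact: nnfun_muleindic_ge0.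
apply: eq_fsbigr => r; rewrite inE => -[t _ <-].
under eq_integral do rewrite EFinM.
rewrite integralZl_indic_nnsfun//.
under [RHS]eq_integral do rewrite EFinM -muleA.
have mI : measurable (g @^-1` [set g t]) by exact: measurable_funPTI.
rewrite ge0_integralZl ?lee_fin//; last 2 first.
- by apply: emeasurable_funM => //; exact/measurable_EFinP.
- by move=> x _; rewrite mule_ge0 ?lee_fin.
rewrite integral_indic// setIT nuE// integral_mkcond; congr (_ * _).
by apply: eq_integral => x _; rewrite muleC epatch_indic.
Qed.

(** Monotone convergence along simple functions increasing to [f], applied on
both sides. *)
Lemma ge0_integral_density (f : T -> R) :
  measurable_fun setT f -> (forall x, (0 <= f x)%R) ->
  \int[nu]_x (f x)%:E = \int[mu]_x (f x * h x)%:E.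
Proof.
move=> mf f0.
have mfE : measurable_fun setT (EFin \o f) by exact/measurable_EFinP.
pose g := nnsfun_approx measurableT mfE.
have gf x : (g n x)%:E @[n --> \oo] --> (f x)%:E.
  apply: (@cvg_nnsfun_approx _ _ _ _ measurableT _ mfE) => // y _.
  by rewrite lee_fin.
have nd_g x m n : (m <= n)%N -> (g m x <= g n x)%R.
  by move=> mn; exact/lefP/nd_nnsfun_approx.
have nuf : \int[nu]_x (g n x)%:E @[n --> \oo] --> \int[nu]_x (f x)%:E.
  have -> : \int[nu]_x (f x)%:E = \int[nu]_x lim ((g n x)%:E @[n --> \oo]).
    by apply: eq_integral => x _; apply/esym/cvg_lim.
  apply: cvg_monotone_convergence => //.
  - by move=> n; exact/measurable_EFinP.
  - by move=> n x _; rewrite lee_fin.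
  - by move=> x _ m n mn; rewrite lee_fin nd_g.
have muf : \int[mu]_x (g n x * h x)%:E @[n --> \oo] -->
           \int[mu]_x (f x * h x)%:E.
  have -> : \int[mu]_x (f x * h x)%:E =
            \int[mu]_x lim ((g n x * h x)%:E @[n --> \oo]).
    apply: eq_integral => x _; apply/esym/cvg_lim => //.
    under eq_fun do rewrite EFinM; rewrite EFinM.
    by apply: cvgeZr => //; exact: gf.
  apply: cvg_monotone_convergence => //.
  - by move=> n; apply/measurable_EFinP; exact: measurable_funM.
  - by move=> n x _; rewrite lee_fin mulr_ge0.
  - by move=> x _ m n mn; rewrite lee_fin ler_wpM2r// nd_g.
rewrite -(cvg_lim _ nuf)// -(cvg_lim _ muf)//.
by congr (limn _); apply/funext => n; exact: integral_density_nnsfun.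
Qed.

End integral_of_density.

(** * Borel measures and continuous functions *)

Section borel_measures.
Context {R : realType}.
Implicit Types X Y : compactMetricType R.

(** The points whose ball of radius [1 / (n + 1)] stays inside [U] lie at a
positive distance from the complement of [U], so a Urysohn function separates
the two sets; these sets of points exhaust [U] as [n] grows. *)
Lemma exists_cvg_indic X (U : set X) : open U ->
  exists f : nat -> X -> R, [/\ forall n, continuous (f n),
    forall n x, 0 <= f n x <= 1 &
    forall x, f n x @[n --> \oo] --> (\1_U x : R)].
Proof.
move=> oU; pose V n := [set x : X | ball x n.+1%:R^-1 `<=` U].
have sepV n : uniform_separator (~` U) (V n).
  apply: uniform_separatorW.
  exists [set xy : X * X | ball xy.1 (n.+1%:R^-1 : R) xy.2].
    by rewrite -entourage_ballE; exists n.+1%:R^-1 => //=; rewrite invr_gt0.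
  rewrite -subset0 => -[a b] /= [[Ua Vb]] /ball_sym ab.
  by apply: Ua; exact: Vb.
exists (fun n => Urysohn (~` U) (V n)); split.
- by move=> n; exact: Urysohn_continuous.
- move=> n x.
  have /= := @Urysohn_range _ R (~` U) (V n) (Urysohn (~` U) (V n) x).
  by rewrite in_itv/=; apply; exists x.
- move=> x; have [Ux|nUx] := pselect (U x).
    rewrite indicE mem_set//; apply: cvg_near_cst.
    have /nbhs_ballP[e /= e0 eU] : nbhs x U by exact: open_nbhs_nbhs.
    near=> n; apply: (Urysohn_sub1 (sepV n)); exists x => //.
    apply: subset_trans eU; apply: le_ball; apply: ltW.
    by near: n; exact: near_infty_natSinv_lt (PosNum e0).
  rewrite indicE memNset//; apply: cvg_near_cst; near=> n.
  by apply: (Urysohn_sub0 (sepV n)); exists x.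
Unshelve. all: by end_near. Qed.

(** The open sets generate the Borel sets and are stable under intersection, so
agreement on them is enough; there it follows by dominated convergence from
continuous approximations of the indicator function. *)
Lemma eq_measure_continuous X
    (m1 m2 : {finite_measure set (borel X) -> \bar R}) :
  (forall f : X -> R, continuous f -> (forall x, 0 <= f x) ->
    (\int[m1]_x (f x)%:E = \int[m2]_x (f x)%:E)%E) ->
  forall E, measurable E -> m1 E = m2 E.
Proof.
move=> m12; apply: (@measure_unique _ R (borel X) (@open X) (fun=> setT)) => //.
- exact: openI.
- by move=> _; exact: openT.
- by rewrite bigcup_const//; exists 0%N.
- move=> U oU; have [f [cf f01 fU]] := exists_cvg_indic oU.
  have mU : measurable (U : set (borel X)) by exact: sub_sigma_algebra.
  have cvgU (m : {finite_measure set (borel X) -> \bar R}) :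
      (\int[m]_x (f n x)%:E @[n --> \oo] --> m U)%E.
    have -> : m U = (\int[m]_x (\1_(U : set (borel X)) x)%:E)%E.
      by rewrite integral_indic// setIT.
    have [|||||_ _] := @dominated_convergence _ _ _ m setT measurableT
      (fun n x => (f n x)%:E) (fun x => (\1_U x)%:E) (cst 1%E).
    + by move=> n; apply/measurable_EFinP; exact: continuous_borel_measurable.
    + exact/measurable_EFinP.
    + by apply: aeW => x _; apply: cvg_EFin; [exact: nearW|exact: fU].
    + exact: finite_measure_integrable_cst.
    + apply: aeW => x n _ /=.
      by have /andP[f0 f1] := f01 n x; rewrite ger0_norm// lee_fin.
    + exact.
  have f12 : (fun n => \int[m1]_x (f n x)%:E)%E =
      (fun n => \int[m2]_x (f n x)%:E)%E.
    apply/funext => n; apply: m12 => // x.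
    by have /andP[] := f01 n x.
  have cvg1 := cvgU m1; rewrite f12 in cvg1.
  exact: (cvg_unique (@ereal_hausdorff R) cvg1 (cvgU m2)).
- by move=> _; exact: fin_num_fun_lty.
Qed.

End borel_measures.

(** * Pairings and duality *)

Section transfer_operators.
Context {R : realType}.
Implicit Types X Y : compactMetricType R.

Lemma continuous_integrable X (m : borel_measure X) (f : X -> R) :
  continuous f -> m.-integrable setT (fun x : borel X => (f x)%:E).
Proof.
move=> cf; apply: measurable_bounded_integrable => //.
- exact: fin_num_fun_lty.
- exact: continuous_borel_measurable.
- have /(@compact_bounded R R^o) : compact [set f x | x in [set: X]].
    by apply: continuous_compact; [exact: continuous_subspaceT|exact: compactT].
  move=> [M [Mr fM]]; exists M; split => // z Mz x _.
  by apply: fM Mz _ _; exists x.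
Qed.

Lemma pairing_density X (m : borel_measure X) (h : Cplus X) (f : X -> R) :
  continuous f -> (forall x, 0 <= f x) ->
  pairing f (density m h) = pairing (fun x => f x * h x) m.
Proof.
move=> cf f0; apply: ge0_integral_density => //.
- exact: (continuous_borel_measurable (@Cplus_continuous R X h)).
- exact: Cplus_ge0.
- exact: continuous_borel_measurable.
Qed.

Lemma pairingZ X (m : borel_measure X) (a : R) (f : X -> R) :
  0 <= a -> continuous f -> (forall x, 0 <= f x) ->
  pairing (fun x => a * f x) m = (a%:E * pairing f m)%E.
Proof.
move=> a0 cf f0; rewrite /pairing; under eq_integral do rewrite EFinM.
apply: ge0_integralZl => //.
- by apply/measurable_EFinP; exact: continuous_borel_measurable.
- by move=> x _; rewrite lee_fin.
Qed.

Lemma pairing_mscale X (m : borel_measure X) (k : {nonneg R}) (f : X -> R) :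
  continuous f -> (forall x, 0 <= f x) ->
  pairing f (mscale k m) = (k%:num%:E * pairing f m)%E.
Proof.
move=> cf f0; apply: ge0_integral_mscale => //.
- by apply/measurable_EFinP; exact: continuous_borel_measurable.
- by move=> x _; rewrite lee_fin.
Qed.

(** A continuous function is the difference of its positive and negative parts,
both continuous, and both sides of the duality are additive on integrable
functions. *)
Lemma dual_eq_ge0 X Y (A : (X -> R) -> Y -> R)
    (m' : borel_measure Y) (m : borel_measure X) :
  preserves_continuity A ->
  (forall f g x, A (fun y => f y - g y) x = A f x - A g x) ->
  (forall f : X -> R, continuous f -> (forall x, 0 <= f x) ->
    pairing f m = pairing (A f) m') ->
  dual_eq A m' m.
Proof.
move=> cA AB A0 f cf.
pose p x : R := Num.max (f x) 0; pose q x : R := Num.max (- f x) 0.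
have cp : continuous p.
  by move=> x; apply: (@continuous_max _ _ f (cst 0));
    [exact: cf|exact: cst_continuous].
have cq : continuous q.
  by move=> x; apply: (@continuous_max _ _ (\- f) (cst 0));
    [exact: (@cvgN _ R^o _ _ _ _ _ (cf x))|exact: cst_continuous].
have fE : f = fun x => p x - q x.
  apply/funext => x; rewrite /p /q; case: (leP 0 (f x)) => fx.
    by rewrite [Num.max (- _) _]max_r ?oppr_le0// subr0.
  by rewrite [Num.max (- _) _]max_l ?oppr_ge0 ?ltW// sub0r opprK.
have pairingB Z (l : borel_measure Z) (u v : Z -> R) :
    continuous u -> continuous v ->
    pairing (fun x => u x - v x) l = (pairing u l - pairing v l)%E.
  move=> cu cv; rewrite /pairing; under eq_integral do rewrite EFinB.
  by apply: integralB => //; exact: continuous_integrable.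
have -> : A f = fun x => A p x - A q x.
  by rewrite fE; apply/funext => x; exact: AB.
rewrite {1}fE !pairingB//; [|exact: cA|exact: cA].
by rewrite !A0// => x; rewrite le_max lexx orbT.
Qed.

(** * Transfer operators *)

Section one_map.
Variables (X Y : compactMetricType R) (T : X -> Y) (phi : X -> R).
Let L := transfer T phi.

Lemma transferZ a f x : L (fun y => a * f y) x = a * L f x.
Proof.
by rewrite /L /transfer mulr_fsumr; apply: eq_fsbigr => y _; rewrite mulrCA.
Qed.

Lemma transferB f g x : finite_set (T @^-1` [set x]) ->
  L (fun y => f y - g y) x = L f x - L g x.
Proof.
move=> fin; rewrite /L /transfer -mulN1r mulr_fsumr -fsbig_split//=.
by apply: eq_fsbigr => y _; rewrite mulN1r mulrBr.
Qed.

(** On the fibre of [x] the function [g o T] is the constant [g x]. *)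
Lemma transfer_comp g f x : L (fun y => g (T y) * f y) x = g x * L f x.
Proof.
rewrite /L /transfer mulr_fsumr; apply: eq_fsbigr => y.
by rewrite inE => /= ->; rewrite mulrCA.
Qed.

Lemma transfer_ge0 f : (forall y, 0 <= f y) -> forall x, 0 <= L f x.
Proof.
by move=> f0 x; apply: fsumr_ge0 => y _; rewrite mulr_ge0 ?expR_ge0.
Qed.

End one_map.

(** * Eigenfunctions, eigenmeasures and the normalized operator *)

Section eigendata.
Variables (X Y : compactMetricType R) (T : X -> Y) (phi : X -> R).
Variables (lam : {posnum R}) (m : borel_measure X) (m' : borel_measure Y).
Variables (h : Cplus X) (h' : Cplus Y).
Let L := transfer T phi.
Hypothesis cT : continuous T.
Hypothesis cL : preserves_continuity L.
Hypothesis Lh : forall x, L h x = lam%:num * h' x.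
Hypothesis Lm : dual_eq L m' (mscale lam%:num%:nng m).

Let ch := @Cplus_continuous R X h.
Let ch' := @Cplus_continuous R Y h'.

(** The scalar [lam^-1] undoes the one in [L^* m' = lam m]. *)
Lemma pairing_density_transfer (f : X -> R) :
  continuous f -> (forall x, 0 <= f x) ->
  pairing f (density m h) =
  pairing (fun x => lam%:num^-1 * L (fun y => f y * h y) x) m'.
Proof.
move=> cf f0.
have cfh : continuous (fun y => f y * h y).
  by move=> x; apply: continuousM; [exact: cf|exact: ch].
have fh0 y : 0 <= f y * h y by rewrite mulr_ge0// Cplus_ge0.
rewrite pairing_density// pairingZ ?invr_ge0//; last 2 first.
- exact: cL.
- exact: transfer_ge0.
by rewrite -Lm// pairing_mscale// muleA -EFinM mulVf ?mul1e.
Qed.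

(** By [transfer_comp], [L ((g o T) * h) = g * L h = lam * (g * h')]. *)
Lemma pushforward_density (E : set (borel Y)) : measurable E ->
  pushforward (density m h) (T : borel X -> borel Y) E = density m' h' E.
Proof.
move=> mE.
have mT : measurable_fun [set: borel X] (T : borel X -> borel Y).
  apply: (@measurability _ _ (borel X) (borel Y) setT
    (T : borel X -> borel Y) (@open Y) erefl).
  move=> _ [U oU <-]; rewrite setTI; apply: sub_sigma_algebra.
  by move/continuousP : cT; apply.
(* The measure structure of a pushforward depends on the measurability of the
   map, left as an argument of [push]. *)
pose push : {measure set (borel Y) -> \bar R} :=
  pushforward (density m h) (T : borel X -> borel Y).
pose nu := push mT.
have nu_fin : fin_num_fun nu.
  move=> A mA; have mTA : measurable ((T : borel X -> borel Y) @^-1` A).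
    by rewrite -[_ @^-1` _]setTI; exact: (mT measurableT).
  exact: (fin_num_measure (density m h)).
pose nuf : {finite_measure set (borel Y) -> \bar R} :=
  HB.pack (Measure.sort nu) nu (Measure_isFinite.Build _ _ _ nu nu_fin).
apply: (@eq_measure_continuous R Y nuf (density m' h')) mE => g cg g0.
have -> : (\int[nuf]_x (g x)%:E)%E = pairing (g \o T) (density m h).
  apply: (ge0_integral_pushforward mT) => //.
  - by apply/measurable_EFinP; exact: continuous_borel_measurable.
  - by move=> y _; rewrite lee_fin.
rewrite pairing_density_transfer; last 2 first.
- by move=> x; apply: continuous_comp; [exact: cT|exact: cg].
- by move=> x; exact: g0.
rewrite -/(pairing g (density m' h')) pairing_density//.
congr (pairing _ m'); apply/funext => x /=.
by rewrite /L transfer_comp -/L Lh mulrCA mulKf.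
Qed.

Hypothesis h_gt0 : forall x, 0 < h x.
Hypothesis h'_gt0 : forall x, 0 < h' x.
Let L' := transfer T
  (fun y => phi y + ln (h y) - ln (h' (T y)) - ln lam%:num).

(** The exponential of the normalized potential at [y] is
[exp (phi y) * h y / (lam * h' (T y))], and [T y = x] on the fibre of [x]. *)
Lemma transfer_normalized f x :
  L' f x = L (fun y => h y * f y) x / (lam%:num * h' x).
Proof.
rewrite /L' /L /transfer mulr_fsuml; apply: eq_fsbigr => y.
rewrite inE => /= ->; rewrite !expRD !expRN !lnK ?posrE//.
by rewrite invfM; ring.
Qed.

Lemma transfer_normalized1 x : L' (fun=> 1) x = 1.
Proof.
rewrite transfer_normalized (_ : (fun y => _) = h); last first.
  by apply/funext => y; rewrite mulr1.
by rewrite Lh divff// mulf_neq0// gt_eqF.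
Qed.

Lemma transfer_normalized_continuous : preserves_continuity L'.
Proof.
move=> f cf; rewrite (_ : L' f = fun x =>
    L (fun y => h y * f y) x / (lam%:num * h' x)); last first.
  by apply/funext => x; exact: transfer_normalized.
move=> x; apply: continuousM.
  apply: cL => y; apply: continuousM; [exact: ch|exact: cf].
apply: continuousV; first by rewrite mulf_neq0// gt_eqF.
by apply: continuousM; [exact: cst_continuous|exact: ch'].
Qed.

(** The factor [h'] of the density of [mu'] cancels the denominator [h'] of
[L' f], leaving [lam^-1 * L (h * f)] to be integrated against [m']. *)
Lemma dual_transfer_normalized :
  (forall x, finite_set (T @^-1` [set x])) ->
  dual_eq L' (density m' h') (density m h).
Proof.
move=> fin; apply: dual_eq_ge0.
- exact: transfer_normalized_continuous.
- by move=> f g x; exact: transferB.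
move=> f cf f0; rewrite pairing_density_transfer//.
rewrite [RHS]pairing_density; last 2 first.
- exact: transfer_normalized_continuous.
- exact: transfer_ge0.
congr (pairing _ m'); apply/funext => x; rewrite transfer_normalized.
rewrite invfM mulrA mulfVK ?gt_eqF// mulrC.
by congr (_ * _); congr (L _ x); apply/funext => y; rewrite mulrC.
Qed.

End eigendata.
End transfer_operators.

Theorem mainTheorem3 (R : realType) (X : int -> compactMetricType R)
    (T : forall n : int, X n -> X (n + 1)) (phi : forall n : int, X n -> R)
    (T_continuous : forall n : int, continuous (T n))
    (phi_continuous : forall n : int, continuous (phi n))
    (T_finite_fibres : forall (n : int) (x : X (n + 1)),
      finite_set (T n @^-1` [set x])) :
  let L := fun n : int => transfer (T n) (phi n) in
  forall (L_operator : forall n : int, preserves_continuity (L n))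
    (lam : int -> {posnum R}) (m : forall n : int, borel_measure (X n))
    (h : forall n : int, Cplus (X n))
    (L_h : forall (n : int) (x : X (n + 1)),
      L n (h n) x = (lam n)%:num * h (n + 1) x)
    (L_dual_m : forall n : int,
      dual_eq (L n) (m (n + 1)) (mscale (lam n)%:num%:nng (m n)))
    (h_m : forall n : int, pairing (h n) (m n) = 1%E),
  let mu : forall n : int, borel_measure (X n) :=
    fun n => density (m n) (h n) in
  (forall (n : int) (E : set (borel (X (n + 1)))), measurable E ->
    pushforward (mu n) (T n : borel (X n) -> borel (X (n + 1))) E
      = mu (n + 1) E) /\
  ((forall (n : int) (x : X n), 0 < h n x) ->
   let L' := fun n : int =>
     transfer (T n) (normalized_potential T phi lam h n) in
   [/\ forall (n : int) (k : nat) (f : X n -> R), continuous f ->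
         forall x : X (index_add n k),
         iter_op L' n k f x =
           iter_op L n k (fun y => h n y * f y) x
             / ((\prod_(0 <= j < k) (lam (n + j%:Z))%:num) * h (index_add n k) x),
       forall n : int, preserves_continuity (L' n),
       forall (n : int) (x : X (n + 1)), L' n (fun=> 1) x = 1
     & forall n : int, dual_eq (L' n) (mu (n + 1)) (mu n)]).
Proof.
move=> L L_operator lam m h L_h L_dual_m h_m mu; split.
  move=> n E mE.
  exact: (pushforward_density (@T_continuous n) (@L_operator n) (L_h n)
    (L_dual_m n)).
move=> h_gt0 L'; split.
- move=> n k f cf; elim: k => [|k IHk] x /=.
    by rewrite big_geq// mul1r mulrC mulKf// gt_eqF.
  rewrite [LHS](transfer_normalized (T (index_add n k)) (phi (index_add n k))
    (lam (index_add n k)) (h_gt0 (index_add n k)) (h_gt0 (index_add n k + 1))).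
  set a := \prod_(0 <= j < k) (lam (n + j%:Z))%:num in IHk.
  have a_gt0 : 0 < a by apply: prodr_gt0.
  (* The factor h inserted by the outer operator cancels the h in the
     denominator of the k-th iterate. *)
  rewrite (_ : (fun y => _) = fun y =>
      a^-1 * iter_op L n k (fun y => h n y * f y) y); last first.
    apply/funext => y; rewrite IHk invfM; field.
    by rewrite !gt_eqF.
  (* The last factor of the product is indexed by n + k, the outer operator by
     the iterated successor. *)
  rewrite transferZ big_nat_recr//= -/a -(index_addE n k).
  by rewrite /L !invfM; ring.
- move=> n.
  exact: (transfer_normalized_continuous (@L_operator n) (h_gt0 n)
    (h_gt0 (n + 1))).
- move=> n x; exact: (transfer_normalized1 (L_h n) (h_gt0 n) (h_gt0 (n + 1))).
- move=> n; exact: (dual_transfer_normalized (@L_operator n) (L_dual_m n)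
    (h_gt0 n) (h_gt0 (n + 1)) (T_finite_fibres n)).
Qed.
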